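(* Let $X$ be an infinite set and let $G$ be an infinite torsion group with $\mathrm{FAlt}(X)\leqslant G\leqslant \mathrm{Sym}(X)$. Then $G$ has the $R_\infty$ property.
   Context: For a set $X$, $\mathrm{Sym}(X)$ is the group of all permutations of $X$ and $\mathrm{FAlt}(X)$ is the subgroup of even permutations with finite support. A group is torsion if every element has finite order. For a group $G$ and $\phi\in\mathrm{Aut}(G)$ (maps written on the right), elements $a,b\in G$ are $\phi$-twisted conjugate if there is $x\in G$ with $(x^{-1})\phi\, a x=b$; the Reidemeister number $R(\phi)$ is the number of $\phi$-twisted conjugacy classes in $G$. $G$ has the $R_\infty$ property if $R(\phi)=\infty$ (infinitely many classes) for every $\phi\in\mathrm{Aut}(G)$. *)

(* Defs.v *)
From HB Require Import structures.
From mathcomp Require Import all_boot.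
From mathcomp Require Import boolp classical_sets cardinality.

Set Implicit Arguments.
Unset Strict Implicit.
Unset Printing Implicit Defensive.

Local Open Scope classical_set_scope.
Local Open Scope group_scope.

(* The inverse is a field, so that no choice is needed to invert; [symP] shows
   that a permutation is still determined by its values. *)
Record Sym (X : Type) := MkSym {
  sym_fun :> X -> X;
  sym_inv : X -> X;
  sym_funK : cancel sym_fun sym_inv;
  sym_invK : cancel sym_inv sym_fun
}.

Section SymGroup.
Variable X : Type.
Implicit Types s t u : Sym X.

Lemma symP s t : s =1 t <-> s = t.
Proof.
split=> [|-> //]; case: s t => [f f' fK f'K] [g g' gK g'K] /= fg.
have {fg}efg : f = g by apply: funext.
rewrite -{g}efg in gK g'K *.
have efg' : f' = g' by apply: funext => x; rewrite -[in LHS](g'K x) fK.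
rewrite -{g'}efg' in gK g'K *.
by rewrite (Prop_irrelevance fK gK) (Prop_irrelevance f'K g'K).
Qed.

HB.instance Definition _ := gen_eqMixin (Sym X).
HB.instance Definition _ := gen_choiceMixin (Sym X).

Definition sym_one : Sym X := @MkSym X id id (frefl id) (frefl id).

Definition sym_opp s : Sym X := MkSym (sym_invK s) (sym_funK s).

(* Maps act on the right: [s * t] is [s] followed by [t]. *)
Definition sym_mul s t : Sym X :=
  MkSym (can_comp (sym_funK t) (sym_funK s))
        (can_comp (sym_invK s) (sym_invK t)).

Lemma sym_mulA : associative sym_mul.
Proof. by move=> s t u; apply/symP. Qed.

Lemma sym_mul1 : left_id sym_one sym_mul.
Proof. by move=> s; apply/symP. Qed.

Lemma sym_mulr1 : right_id sym_one sym_mul.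
Proof. by move=> s; apply/symP. Qed.

Lemma sym_mulV : left_inverse sym_one sym_opp sym_mul.
Proof. by move=> s; apply/symP => x /=; rewrite sym_invK. Qed.

Lemma sym_mulrV : right_inverse sym_one sym_opp sym_mul.
Proof. by move=> s; apply/symP => x /=; rewrite sym_funK. Qed.

HB.instance Definition _ :=
  isGroup.Build (Sym X) sym_mulA sym_mul1 sym_mulr1 sym_mulV sym_mulrV.

Definition support s : set X := [set x | s x <> x].

Definition transposition t : Prop :=
  exists a b : X, [/\ a <> b, t a = b, t b = a
    & forall x, x <> a -> x <> b -> t x = x].

Definition even_permutation s : Prop :=
  exists ts : seq (Sym X),
    [/\ forall t, t \in ts -> transposition t, ~~ odd (size ts)
      & s = \prod_(t <- ts) t].

Definition FAlt : set (Sym X) :=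
  [set s | finite_set (support s) /\ even_permutation s].

End SymGroup.

Arguments FAlt : clear implicits.

Section TwistedConjugacy.
Variable G : groupType.

Definition torsion : Prop := forall g : G, exists2 n : nat, (0 < n)%N & g ^+ n = 1.

Definition automorphism (phi : G -> G) : Prop :=
  bijective phi /\ {morph phi : x y / x * y}.

Definition twisted_conjugate (phi : G -> G) (a b : G) : Prop :=
  exists x : G, phi x^-1 * a * x = b.

Definition twisted_class (phi : G -> G) (a : G) : set G :=
  [set b | twisted_conjugate phi a b].

(* The Reidemeister number of [phi] is the cardinality of this set. *)
Definition twisted_classes (phi : G -> G) : set (set G) :=
  range (twisted_class phi).

Definition R_infty : Prop :=
  forall phi : G -> G, automorphism phi -> infinite_set (twisted_classes phi).

End TwistedConjugacy.

Arguments torsion : clear implicits.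
Arguments R_infty : clear implicits.

(* Main.v *)
From HB Require Import structures.
Require Import Defs.
From mathcomp Require Import all_boot.
From mathcomp Require Import boolp classical_sets functions cardinality.

Set Implicit Arguments.
Unset Strict Implicit.
Unset Printing Implicit Defensive.

Local Open Scope classical_set_scope.
Local Open Scope group_scope.

(** Every automorphism phi of G is the restriction of conjugation by some r in
    Sym X.  The equation phi x^-1 * a * x = b then says that x conjugates r a
    into r b, so the twisted classes of phi are the G-conjugacy classes of the
    coset r G, translated by r^-1.

    Fixed points separate such classes when G is torsion.  If s ^ x = t, then x
    maps Fix s onto Fix t; if moreover Fix s is contained in Fix t, then
    Fix s, its image under x, its image under x^2, and so on form an increasing
    chain, which comes back to Fix s because x has finite order.  Hence
    Fix s = Fix t ([fixed_points_conj_torsion]).  It remains to find in r FAlt X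
    an infinite sequence whose sets of fixed points are strictly monotone
    ([FAlt_coset_chain]).  If r moves infinitely many points, multiplying by
    suitable 3-cycles fixes more and more of them; otherwise r fixes infinitely
    many points, and 3-cycles move more and more of these.

    That automorphisms come from Sym X ([automorphism_conj]) rests on 3-cycles.
    Among the elements of order 3 they are those t for which [t, g]^30 = 1 for
    every g in FAlt X ([commg_three_cycle], [three_cycle_of_commg]), so
    automorphisms preserve them.  Two 3-cycles t and u with (t u)^2 = 1 are
    inverse to each other or agree at a point that they move, that is, share an
    arc ([common_arc]); so phi sends the 3-cycles (a0 b0 e), for fixed a0 and b0,
    to 3-cycles (a b e'), and r is a0 -> a, b0 -> b, e -> e'.  The (a0 b0 e)
    generate a group containing all 3-cycles ([three_cycles_generate]), so phi
    and conjugation by r agree on 3-cycles; and a permutation is determined by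
    its action on the 3-cycles ([conj_three_cycles_inj]).

    Identities between products of 3-cycles on a few points are reduced to
    computations in nat by numbering the points. *)

(** * Numbering points *)

Lemma fresh_point (X : choiceType) (A : set X) (s : seq X) :
  infinite_set A -> exists2 x, A x & x \notin s.
Proof.
move=> Ainf; have: infinite_set (A `\` [set` s]).
  by apply: infinite_setD => //; apply: finite_seq.
by move=> /infinite_setN0[x [Ax /negP xs]]; exists x.
Qed.

(** Used with s a list of points in a known position and r a list of points in
    unknown position relative to s: the points of s get the first numbers, and
    the finitely many possibilities for the numbers js of the points of r can be
    enumerated. *)
Lemma numbering (X : choiceType) (n : nat) (s r : seq X) :
  infinite_set [set: X] -> uniq s -> size s + size r = n ->
  exists2 h : nat -> X, injective h & s = map h (iota 0 (size s)) /\
    exists2 js, r = map h js & all (fun j => j \in iota 0 n) js.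
Proof.
elim/choicePpointed: X => X in s r *.
  by rewrite emptyE => /(_ (@finite_set0 _)).
move=> Xinf s_uniq <-; pose q := s ++ [seq x <- undup r | x \notin s].
have q_uniq : uniq q.
  rewrite cat_uniq s_uniq filter_uniq ?undup_uniq //= andbT.
  by apply/hasPn => x; rewrite mem_filter => /andP[].
have /infiniteP qinf : infinite_set [set x : X | x \notin q].
  rewrite (_ : [set x | _] = [set: X] `\` [set` q]); last first.
    by apply/seteqP; split=> x /= => [/negP|[_ /negP]].
  by apply: infinite_setD => //; apply: finite_seq.
have [f] : $|{injfun [set: nat] >-> [set x : X | x \notin q]}|.
  exact/pcard_leP.
pose h i := if i < size q then nth (f 0) q i else f (i - size q).
have fq i : f i \notin q by exact: (@funS _ _ _ _ f i).
exists h.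
  move=> i j; rewrite /h.
  case: ltnP => iq; case: ltnP => jq.
  - by move=> /eqP; rewrite nth_uniq // => /eqP.
  - by move=> e; have := fq (j - size q); rewrite -e mem_nth.
  - by move=> e; have := fq (i - size q); rewrite e mem_nth.
  - have finj : injective f by move=> x y; apply: (@inj _ _ _ f); rewrite inE.
    by move/finj => e; rewrite -(subnK iq) e subnK.
split.
  apply: (@eq_from_nth _ (f 0)); rewrite ?size_map ?size_iota // => i ilt.
  rewrite (nth_map 0%N) ?size_iota // nth_iota // /h size_cat ltn_addr //.
  by rewrite nth_cat ilt.
have rq x : x \in r -> x \in q.
  by move=> xr; rewrite mem_cat mem_filter mem_undup xr andbT orbN.
have hP x : x \in r -> h (index x q) = x.
  by move=> /rq xq; rewrite /h index_mem xq nth_index.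
exists [seq index x q | x <- r].
  by rewrite -map_comp -[LHS]map_id; apply/eq_in_map => x /hP.
apply/allP=> _ /mapP[x /rq xq ->]; rewrite mem_iota add0n.
rewrite -index_mem in xq; apply: leq_trans xq _.
rewrite size_cat leq_add2l size_filter.
by apply: leq_trans (count_size _ _) (size_undup _).
Qed.

Arguments numbering [X n s] r.

(** * Cycles of length three *)

Definition swap_fun (T : eqType) (a b x : T) : T :=
  if x == a then b else if x == b then a else x.

Lemma swap_funK (T : eqType) (a b : T) : involutive (swap_fun a b).
Proof.
move=> x; rewrite /swap_fun; case: (eqVneq x a) => [->|xa].
  by rewrite eqxx; case: eqP.
by case: (eqVneq x b) => [->|xb]; rewrite ?eqxx // (negPf xa) (negPf xb).
Qed.

Definition swap (X : eqType) (a b : X) : Sym X :=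
  MkSym (swap_funK a b) (swap_funK a b).

(** The left factor of a product acts first, so for distinct points this is the
    cycle a -> b -> c -> a. *)
Definition cyc (X : eqType) (a b c : X) : Sym X := swap a b * swap a c.

Definition cyc_fun (T : eqType) (a b c x : T) : T :=
  swap_fun a c (swap_fun a b x).

Section Tracking.
Variables (X : eqType) (h : nat -> X).
Hypothesis h_inj : injective h.

(** When h is injective, such an f turns an identity about s into a
    computation. *)
Definition tracks (s : Sym X) (f : nat -> nat) := forall i, s (h i) = h (f i).

Lemma tracks_cyc a b c : tracks (cyc (h a) (h b) (h c)) (cyc_fun a b c).
Proof.
have tr_swap d e i : swap_fun (h d) (h e) (h i) = h (swap_fun d e i).
  by rewrite /swap_fun !(inj_eq h_inj); do 2?case: eqP.
by move=> i; rewrite /= !tr_swap.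
Qed.

Lemma tracksM s t f g :
  tracks s f -> tracks t g -> tracks (s * t) (fun i => g (f i)).
Proof. by move=> sf tg i /=; rewrite sf tg. Qed.

Lemma tracksX s f n : tracks s f -> tracks (s ^+ n) (iter n f).
Proof.
move=> sf; elim: n => [|n IHn] i //; rewrite expgSr /= IHn sf //.
Qed.

Lemma tracks_id s f n :
  tracks s f -> s = 1 -> all (fun i => f i == i) (iota 0 n).
Proof.
by move=> sf s1; apply/allP => i _; rewrite -(inj_eq h_inj) -sf s1.
Qed.

End Tracking.

Lemma symM X (s t : Sym X) x : (s * t) x = t (s x). Proof. by []. Qed.
Lemma sym1 X x : (1 : Sym X) x = x. Proof. by []. Qed.
Lemma symKV X (s : Sym X) x : s (s^-1 x) = x. Proof. exact: sym_invK. Qed.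
Lemma symVK X (s : Sym X) x : s^-1 (s x) = x. Proof. exact: sym_funK. Qed.
Lemma sym_inj X (s : Sym X) : injective s. Proof. exact: can_inj (symVK s). Qed.

Section Cycles.
Variable X : choiceType.
Implicit Types (a b c x : X) (s t u : Sym X).

Lemma cyc1 a b c : b != a -> b != c -> cyc a b c a = b.
Proof.
by move=> ba bc; rewrite /= /swap_fun eqxx (negPf ba) (negPf bc).
Qed.

Lemma cyc2 a b c : cyc a b c b = c.
Proof.
by rewrite /= /swap_fun eqxx; case: (eqVneq b a) => [->|_]; rewrite eqxx.
Qed.

Lemma cyc3 a b c : a != c -> c != b -> cyc a b c c = a.
Proof.
move=> ac cb; rewrite /= /swap_fun (eq_sym c a) (negPf ac) (negPf cb).
by rewrite (eq_sym c a) (negPf ac) eqxx.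
Qed.

Lemma cyc_out a b c x : x \notin [:: a; b; c] -> cyc a b c x = x.
Proof.
rewrite !inE !negb_or => /and3P[xa xb xc].
by rewrite /= /swap_fun (negPf xa) (negPf xb) (negPf xa) (negPf xc).
Qed.

Lemma uniq3 a b c : uniq [:: a; b; c] = [&& a != b, a != c & b != c].
Proof. by rewrite /= !inE negb_or andbT andbA. Qed.

Lemma cyc_eq a b c s : uniq [:: a; b; c] ->
  s a = b -> s b = c -> s c = a -> (forall x, x \notin [:: a; b; c] -> s x = x) ->
  s = cyc a b c.
Proof.
rewrite uniq3 => /and3P[ab ac bc] sa sb sc sx.
apply/symP => x; have [|xabc] := boolP (x \in [:: a; b; c]).
  rewrite !inE => /or3P[] /eqP->.
  - by rewrite cyc1 // eq_sym.
  - by rewrite cyc2.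
  - by rewrite cyc3 // eq_sym.
by rewrite sx // cyc_out.
Qed.

Lemma cyc_rot a b c : uniq [:: a; b; c] -> cyc a b c = cyc b c a.
Proof.
move=> abc; have := abc; rewrite uniq3 => /and3P[ab ac bc].
apply: cyc_eq => [||||x xbca].
- by rewrite (rot_uniq 1%N [:: a; b; c]).
- by rewrite cyc2.
- by rewrite cyc3 // eq_sym.
- by rewrite cyc1 // eq_sym.
- by rewrite cyc_out // -(mem_rot 1%N).
Qed.

Lemma cycV a b c : uniq [:: a; b; c] -> (cyc a b c)^-1 = cyc a c b.
Proof.
rewrite uniq3 => /and3P[ab ac bc].
apply: cyc_eq => [||||x xacb]; first by rewrite uniq3 ac ab eq_sym bc.
all: apply: (@sym_inj _ (cyc a b c)); rewrite symKV.
- by rewrite cyc3 // eq_sym.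
- by rewrite cyc2.
- by rewrite cyc1 // eq_sym.
- rewrite cyc_out //; move: xacb; rewrite !inE !negb_or.
  by move=> /and3P[-> -> ->].
Qed.

Lemma cycJ a b c s : cyc a b c ^ s = cyc (s a) (s b) (s c).
Proof.
have swJ d e x : s (swap_fun d e (s^-1 x)) = swap_fun (s d) (s e) x.
  rewrite /swap_fun -[x in RHS](symKV s) !(inj_eq (@sym_inj _ s)).
  by do 2?case: eqP => _ //; rewrite symKV.
apply/symP => x; rewrite -[LHS]/(s (swap_fun a c (swap_fun a b (s^-1 x)))).
by rewrite -[RHS]/(swap_fun _ _ (swap_fun _ _ x)) -!swJ symVK.
Qed.

Lemma cyc_FAlt a b c : uniq [:: a; b; c] -> FAlt X (cyc a b c).
Proof.
rewrite uniq3 => /and3P[ab ac bc].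
have swP d e : d != e -> transposition (swap d e).
  move=> de; exists d, e; split=> [||| x /eqP/negPf xd /eqP/negPf xe].
  - exact/eqP.
  - by rewrite /= /swap_fun eqxx.
  - by rewrite /= /swap_fun eq_sym (negPf de) eqxx.
  - by rewrite /= /swap_fun xd xe.
split.
  apply: (@sub_finite_set _ _ [set` [:: a; b; c]]); last exact: finite_seq.
  by move=> x; rewrite /support /=; apply: contra_notP => /negP; apply: cyc_out.
exists [:: swap a b; swap a c]; split=> [t||] //.
  by rewrite !inE => /orP[] /eqP->; apply: swP.
by rewrite !big_cons big_nil mulg1.
Qed.

Lemma FAlt1 : FAlt X 1.
Proof.
split; first by apply: (sub_finite_set _ (@finite_set0 X)) => x /=; apply.
by exists [::]; split=> //; rewrite big_nil.
Qed.

Lemma FAltM s t : FAlt X s -> FAlt X t -> FAlt X (s * t).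
Proof.
move=> [sfin [ss [ssT ss_even es]]] [tfin [ts [tsT ts_even et]]]; split.
  have := conj sfin tfin; rewrite -finite_setU; apply: sub_finite_set => x stx.
  have [sx|] := EM (s x = x); last by left.
  by right => tx; apply: stx; rewrite symM sx.
exists (ss ++ ts); split; last by rewrite es et big_cat.
- by move=> r; rewrite mem_cat => /orP[/ssT|/tsT].
- by rewrite size_cat oddD (negPf ss_even) (negPf ts_even).
Qed.

End Cycles.
(** * Recognizing three-cycles inside a group *)

Section ThreeCycles.
Variable X : choiceType.
Hypothesis X_inf : infinite_set [set: X].
Implicit Types (a b c p x : X) (s t u v : Sym X).

Definition three_cycle t :=
  exists a b c, uniq [:: a; b; c] /\ t = cyc a b c.

Lemma three_cycle_cyc a b c : uniq [:: a; b; c] -> three_cycle (cyc a b c).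
Proof. by move=> abc; exists a, b, c. Qed.

Lemma three_cycleJ t s : three_cycle t -> three_cycle (t ^ s).
Proof.
move=> [a [b [c [abc ->]]]]; rewrite cycJ; apply: three_cycle_cyc.
by move: abc; rewrite !uniq3 !(inj_eq (@sym_inj _ s)).
Qed.

Lemma three_cycle_at t p : three_cycle t -> t p != p ->
  uniq [:: p; t p; t (t p)] /\ t = cyc p (t p) (t (t p)).
Proof.
move=> [a [b [c [abc ->]]]] tp.
have [tap tbp tcp] : [/\ cyc a b c a = b, cyc a b c b = c & cyc a b c c = a].
  move: abc; rewrite uniq3 => /and3P[ab ac bc].
  by split; rewrite ?cyc2 ?cyc1 ?cyc3 // eq_sym.
have : p \in [:: a; b; c] by apply: contra_neqT tp; apply: cyc_out.
rewrite !inE => /or3P[] /eqP->; rewrite ?tap ?tbp ?tcp ?tap ?tbp.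
- by [].
- by rewrite (rot_uniq 1%N [:: a; b; c]) (cyc_rot abc).
- rewrite (rot_uniq 2%N [:: a; b; c]) !(cyc_rot abc).
  by rewrite cyc_rot ?(rot_uniq 1%N [:: a; b; c]).
Qed.

Lemma three_cycle_order t : three_cycle t -> t ^+ 3 = 1 /\ t <> 1.
Proof.
move=> [a [b [c [abc ->]]]]; split; last first.
  move: abc; rewrite uniq3 => /and3P[ab ac bc] /symP/(_ a).
  by rewrite cyc1 1?[b == a]eq_sym // sym1 => ba; rewrite ba eqxx in ab.
apply/symP => x; have [h h_inj [[ha hb hc]]] := numbering [:: x] X_inf abc (erefl 4).
case=> -[|p []] // [->] /andP[p_lt _].
rewrite ha hb hc (tracksX 3 (tracks_cyc h_inj 0 1 2)) sym1; congr h; apply/eqP.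
by move: p p_lt; apply/allP.
Qed.

(** The commutator of a 3-cycle with any g is a product of two 3-cycles, hence
    an even permutation of at most five points. *)
Lemma commg_three_cycle t s : three_cycle t -> [~ t, s] ^+ 30 = 1.
Proof.
move=> /[dup] /(three_cycleJ s)[d [e [f [def ts]]]] [a [b [c [abc et]]]].
rewrite commgEl ts et cycV //.
apply/symP => x; move: def.
have [h h_inj [[-> -> ->]]] := numbering [:: d; e; f; x] X_inf abc (erefl 7).
case=> -[|i [|j [|k [|p []]]]] // [-> -> -> ->] /and5P[i_lt j_lt k_lt p_lt _].
rewrite -[X in uniq X]/(map h [:: i; j; k]).
rewrite (map_inj_uniq h_inj) => ijk.
rewrite (tracksX 30 (tracksM (tracks_cyc h_inj 0 2 1) (tracks_cyc h_inj i j k))).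
rewrite sym1; congr h; apply/eqP; apply: contraTT ijk; apply/implyP.
move: p p_lt; apply/allP; move: k k_lt; apply/allP; move: j j_lt; apply/allP.
by move: i i_lt; apply/allP; vm_compute.
Qed.

(** An element u of order 3 that is not a 3-cycle has two nontrivial cycles,
    (0 1 2) and (3 4 5) in a numbering, and there is a seventh point 6.  For
    g = (0 1 3)(0 6 4), the commutator [u, g] depends only on the values of u at
    0, 1, 3, 4 and 6: it has a cycle of length 7 if u fixes 6, and one of length
    4 if u moves 6 to an eighth point 7; neither length divides 30. *)
Lemma three_cycle_of_commg u :
  u ^+ 3 = 1 -> u <> 1 -> (forall g, FAlt X g -> [~ u, g] ^+ 30 = 1) ->
  three_cycle u.
Proof.
move=> u3 u1 ug; apply: contrapT => not3.
have uuu x : u (u (u x)) = x by rewrite -{2}(sym1 x) -u3.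
pose orbit x := [:: x; u x; u (u x)].
have orbit_uniq x : u x != x -> uniq (orbit x).
  move=> ux; rewrite uniq3 (inj_eq (@sym_inj _ u)) eq_sym ux /= andbT.
  by rewrite -(inj_eq (@sym_inj _ u)) uuu.
have orbit_stable x y : (u y \in orbit x) = (y \in orbit x).
  rewrite !inE -{1}(uuu x) !(inj_eq (@sym_inj _ u)).
  by do 3!case: (y == _).
have [a ua] : exists a, u a != a.
  apply: contra_notP u1 => noa; apply/symP => x.
  by apply: contra_notP noa => /eqP ux; exists x.
have [b [ub ba]] : exists b, u b != b /\ b \notin orbit a.
  apply: contra_notP not3 => nob; exists a, (u a), (u (u a)).
  split; first exact: orbit_uniq.
  apply: cyc_eq => // [|x xa]; first exact: orbit_uniq.
  by apply: contra_notP nob => /eqP ux; exists x.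
pose s := orbit a ++ orbit b.
have s_stable x : (u x \in s) = (x \in s) by rewrite !mem_cat !orbit_stable.
have s_uniq : uniq s.
  rewrite cat_uniq !orbit_uniq // andbT; apply/hasPn/allP.
  by apply/and4P; split=> //; rewrite !orbit_stable.
have [p _ ps] := fresh_point s X_inf.
have [h h_inj [j [s_h up pj]]] : exists2 h : nat -> X, injective h &
    exists j, [/\ s = map h (iota 0 6), u (h 6) = h j & (j == 6) || (j == 7)].
  have [up|up] := eqVneq (u p) p.
    have q_uniq : uniq (rcons s p) by rewrite rcons_uniq ps.
    have [h h_inj [hs _]] := numbering [::] X_inf q_uniq (erefl 7).
    exists h => //; exists 6; split=> //.
      exact: (congr1 (take 6) hs).
    by have <- : p = h 6 by case: hs.
  have q_uniq : uniq (rcons (rcons s p) (u p)).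
    by rewrite !rcons_uniq mem_rcons in_cons negb_or up s_stable ps.
  have [h h_inj [hs _]] := numbering [::] X_inf q_uniq (erefl 8).
  exists h => //; exists 7; split=> //.
    exact: (congr1 (take 6) hs).
  by have [<- <-] : p = h 6 /\ u p = h 7 by case: hs.
have h_uniq i k l : uniq [:: i; k; l] -> uniq [:: h i; h k; h l].
  by rewrite -[X in _ -> uniq X]/(map h [:: i; k; l]) (map_inj_uniq h_inj).
move: s_h => [] a0 ua1 uua2 b3 ub4 uub5.
have [u0 u1' u3' u4] : [/\ u (h 0) = h 1%N, u (h 1%N) = h 2,
    u (h 3) = h 4 & u (h 4) = h 5].
  by rewrite -a0 -b3 -ua1 -ub4.
have /ug : FAlt X (cyc (h 0) (h 1%N) (h 3) * cyc (h 0) (h 6) (h 4)).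
  by apply: FAltM; apply: cyc_FAlt; apply: h_uniq.
(* [u, g] = (g^-1 ^ u) g, and g^-1 ^ u is obtained by applying u to the points
   in the cycles of g^-1. *)
rewrite commgEr conjVg conjMg !cycJ u0 u1' u3' u4 up invgM !cycV; first last.
- by case/orP: pj => /eqP->; apply: h_uniq.
- exact: h_uniq.
have tr := tracks_cyc h_inj.
move=> /symP/(_ (h 0)).
rewrite (tracksX 30 (tracksM (tracksM (tr _ _ _) (tr _ _ _))
                             (tracksM (tr _ _ _) (tr _ _ _)))).
by rewrite sym1 => /h_inj; case/orP: pj => /eqP->; vm_compute.
Qed.

(** Of two 3-cycles with a product of order at most 2, the possible relative
    positions are (a b c), (a b d) and (a b c), (a c b): products of disjoint
    3-cycles have order 3, those of 3-cycles with one common point have order 5,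
    and (a b c)(b a d) and (a b c)(a b c) have order 3. *)
Lemma common_arc t u : three_cycle t -> three_cycle u -> (t * u) ^+ 2 = 1 ->
  u = t^-1 \/ exists2 p, t p <> p & t p = u p.
Proof.
move=> [a [b [c [abc ->]]]] [d [e [f [def ->]]]] tu2; rewrite cycV //.
have [arc|noarc] := EM (exists2 p, cyc a b c p <> p & cyc a b c p = cyc d e f p).
  by right.
left; apply/symP => x; move: def tu2 noarc.
have [h h_inj [[-> -> ->]]] := numbering [:: d; e; f; x] X_inf abc (erefl 7).
case=> -[|i [|j [|k [|p []]]]] // [-> -> -> ->] /and5P[i_lt j_lt k_lt p_lt _].
rewrite -[X in uniq X]/(map h [:: i; j; k]) (map_inj_uniq h_inj) => ijk tu2 noarc.
have tr := tracks_cyc h_inj.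
rewrite !tr; congr h; apply/eqP.
have {}noarc : ~~ has (fun q => (cyc_fun 0 1%N 2 q != q) &&
    (cyc_fun 0 1%N 2 q == cyc_fun i j k q)) (iota 0 7).
  apply/hasP => -[q _ /andP[tq /eqP tuq]]; case: noarc; exists (h q).
    by rewrite tr => /h_inj/eqP; apply/negP.
  by rewrite !tr tuq.
move: noarc; apply/implyP;
move: {tu2}(tracks_id h_inj 7 (tracksX 2 (tracksM (tr _ _ _) (tr _ _ _))) tu2).
apply/implyP; move: ijk; apply/implyP.
move: p p_lt; apply/allP; move: k k_lt; apply/allP; move: j j_lt; apply/allP.
by move: i i_lt; apply/allP; vm_compute.
Qed.

Lemma cyc_arc_square a b c d : uniq [:: a; b; c; d] ->
  (cyc a b c * cyc a b d) ^+ 2 = 1.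
Proof.
move=> abcd; apply/symP => x.
have [h h_inj [[-> -> -> ->]]] := numbering [:: x] X_inf abcd (erefl 5).
case=> -[|p []] // [->] /andP[p_lt _]; have tr := tracks_cyc h_inj.
rewrite (tracksX 2 (tracksM (tr _ _ _) (tr _ _ _))) sym1; congr h; apply/eqP.
by move: p p_lt; apply/allP.
Qed.

Lemma three_cycle_arc t a b : three_cycle t -> a != b -> t a = b ->
  [/\ t b != a, t b != b & t = cyc a b (t b)].
Proof.
move=> t3 ab ta; have [] := three_cycle_at t3 (p := a); first by rewrite ta eq_sym.
by rewrite ta uniq3 => /and3P[_ atb btb] et; rewrite eq_sym atb eq_sym btb.
Qed.

(** The inverse of one of (a b c), (a b d) shares no arc with the other, so v
    shares an arc with each of them by [common_arc].  Avoiding a -> b would force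
    v to pass through all of a, b, c, d, or to enter or leave a point twice. *)
Lemma third_common_arc a b c d v : uniq [:: a; b; c; d] -> three_cycle v ->
  (cyc a b c * v) ^+ 2 = 1 -> (cyc a b d * v) ^+ 2 = 1 -> v a = b.
Proof.
move=> abcd [e [f [g [efg ->]]]]; move: efg.
have [h h_inj [[-> -> -> ->]]] := numbering [:: e; f; g] X_inf abcd (erefl 7).
case=> -[|i [|j [|k []]]] // [-> -> ->] /and4P[i_lt j_lt k_lt _].
rewrite -[X in uniq X]/(map h [:: i; j; k]) (map_inj_uniq h_inj) => ijk tv uv.
have tr := tracks_cyc h_inj.
rewrite !tr; congr h; apply/eqP.
move: {uv}(tracks_id h_inj 7 (tracksX 2 (tracksM (tr _ _ _) (tr _ _ _))) uv); apply/implyP.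
move: {tv}(tracks_id h_inj 7 (tracksX 2 (tracksM (tr _ _ _) (tr _ _ _))) tv); apply/implyP.
move: ijk; apply/implyP.
move: k k_lt; apply/allP; move: j j_lt; apply/allP.
by move: i i_lt; apply/allP; vm_compute.
Qed.

(** A group K containing all (a b e) moves (a, b) to every pair of distinct
    points: the cycles (a b e) and their inverses move a anywhere, and the
    conjugates (b y f) of (a b f) by (a b y) then move b while fixing a.  Hence
    every 3-cycle is K-conjugate to some (a b e). *)
Lemma three_cycles_generate (K : Sym X -> Prop) a b : a != b ->
  (forall s t, K s -> K t -> K (s * t)) -> (forall s, K s -> K s^-1) ->
  (forall e, e != a -> e != b -> K (cyc a b e)) ->
  forall t, three_cycle t -> K t.
Proof.
move=> ab KM KV Kab _ [x [y [z [xyz ->]]]].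
have KJ s t : K s -> K t -> K (t ^ s).
  by move=> Ks Kt; exact: KM (KV _ Ks) (KM _ _ Kt Ks).
have [c _] := fresh_point [:: a; b] X_inf; rewrite !inE negb_or => /andP[ca cb].
have K1 : K 1 by rewrite -(mulgV (cyc a b c)); apply: KM; [|apply: KV]; apply: Kab.
have [k1 Kk1 k1a] : exists2 k, K k & k a = x.
  have [->|xa] := eqVneq x a; first by exists 1.
  have [->|xb] := eqVneq x b.
    by exists (cyc a b c); [exact: Kab|rewrite cyc1 1?eq_sym // eq_sym].
  exists (cyc a b x)^-1; first by apply: KV; apply: Kab.
  by apply: (@sym_inj _ (cyc a b x)); rewrite symKV cyc3 // eq_sym.
have [k2 Kk2 [k2a k2b]] : exists2 k, K k & k a = a /\ k b = k1^-1 y.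
  pose y' := k1^-1 y; rewrite -/y'.
  have y'a : y' != a.
    rewrite -(inj_eq (@sym_inj _ k1)) symKV k1a.
    by move: xyz; rewrite uniq3 eq_sym => /and3P[].
  have [->|y'b] := eqVneq y' b; first by exists 1.
  have [f _] := fresh_point [:: a; b; y'] X_inf.
  rewrite !inE !negb_or => /and3P[fa fb fy'].
  exists (cyc b y' f).
    have -> : cyc b y' f = cyc a b f ^ cyc a b y'.
      by rewrite cycJ cyc1 ?cyc2 ?cyc_out ?inE ?negb_or ?fa ?fb ?fy' // eq_sym.
    by apply: KJ; apply: Kab.
  split; last by rewrite cyc1 // eq_sym.
  by rewrite cyc_out // !inE !negb_or ab eq_sym y'a eq_sym fa.
have [k Kk [kx ky]] : exists2 k, K k & k a = x /\ k b = y.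
  by exists (k2 * k1); [exact: KM|rewrite !symM k2a k2b symKV].
move: xyz; rewrite uniq3 => /and3P[_ xz yz].
rewrite -kx -ky -(symKV k z) -cycJ; apply: KJ => //.
by apply: Kab; rewrite -(inj_eq (@sym_inj _ k)) symKV ?kx ?ky eq_sym.
Qed.

(** Conjugating (p y z) and (p y' z'), which have only p in common, by s and by t
    shows that s p lies in both {t p, t y, t z} and {t p, t y', t z'}. *)
Lemma conj_three_cycles_inj s t :
  (forall u, three_cycle u -> u ^ s = u ^ t) -> s = t.
Proof.
move=> st; apply/symP => p.
have meet y z : uniq [:: p; y; z] -> s p \in [:: t p; t y; t z].
  move=> pyz; have [pys pzs] : y != p /\ y != z.
    by move: pyz; rewrite uniq3 eq_sym => /and3P[].
  apply/negPn/negP => sp; have := st _ (three_cycle_cyc pyz).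
  rewrite !cycJ => /symP/(_ (s p)); rewrite [RHS]cyc_out //.
  rewrite cyc1 ?(inj_eq (@sym_inj _ s)) // => /(@sym_inj _ s)/eqP.
  by rewrite (negPf pys).
have [h h_inj [[ep] _]] := numbering [::] X_inf (isT : uniq [:: p]) (erefl 1%N).
have h_uniq i j : uniq [:: 0; i; j] -> uniq [:: p; h i; h j].
  by rewrite ep -[X in _ -> uniq X]/(map h [:: 0; i; j]) (map_inj_uniq h_inj).
have := meet _ _ (h_uniq 1%N 2 isT); rewrite !inE => /or3P[/eqP //||] /eqP e.
all: have := meet _ _ (h_uniq 3 4 isT).
all: by rewrite e ep !inE !(inj_eq (@sym_inj _ t)) !(inj_eq h_inj).
Qed.

End ThreeCycles.

(** * Automorphisms are conjugations *)

Section Automorphisms.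
Variables (X : choiceType) (P : pred (Sym X)) (G : subGroupType P).
Hypothesis X_inf : infinite_set [set: X].
Hypothesis FAlt_G : FAlt X `<=` [set` P].

Lemma FAlt_lift s : FAlt X s -> exists g : G, val g = s.
Proof. by move=> /FAlt_G Ps; exists (Sub s Ps); rewrite SubK. Qed.

(** Gives access to the theory of group morphisms for a bare function. *)
Lemma automorphism_morphism (phi : G -> G) :
  automorphism phi -> exists F : UMagmaMorphism.type G G, phi = F.
Proof.
move=> [_ phiM]; have phi1 : phi 1 = 1.
  by apply: (@mulgI _ (phi 1)); rewrite -phiM !mulg1.
pose F : UMagmaMorphism.type G G :=
  HB.pack phi (isUMagmaMorphism.Build G G phi (phi1, phiM)).
by exists F.
Qed.

Lemma automorphism_inv (phi psi : G -> G) :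
  automorphism phi -> cancel phi psi -> cancel psi phi -> automorphism psi.
Proof.
move=> [_ phiM] phiK psiK; split; first by exists phi.
by move=> x y; rewrite -[x in LHS]psiK -[y in LHS]psiK -phiM phiK.
Qed.

Lemma automorphism_three_cycle phi (g : G) :
  automorphism phi -> three_cycle (val g) -> three_cycle (val (phi g)).
Proof.
move=> phi_aut g3; have [F phiF] := automorphism_morphism phi_aut.
have [[psi phiK psiK] _] := phi_aut.
have [gX g1] := three_cycle_order X_inf g3.
apply: (three_cycle_of_commg X_inf) => [||s /FAlt_lift[h <-]].
- have {}gX : g ^+ 3 = 1 by apply: val_inj; rewrite gmulfXn val1.
  by rewrite -gmulfXn phiF -gmulfXn gX !gmulf1.
- move=> e; apply: g1; have {e}phig1 : phi g = 1 by apply: val_inj; rewrite val1.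
  have -> : g = 1 by rewrite -[LHS]phiK phig1 -[RHS]phiK phiF gmulf1.
  exact: val1.
- rewrite -gmulfR -gmulfXn -[h]psiK phiF -gmulfR -gmulfXn.
  have -> : [~ g, psi h] ^+ 30 = 1; last by rewrite !gmulf1.
  by apply: val_inj; rewrite gmulfXn gmulfR commg_three_cycle // val1.
Qed.

(** The product of any further (a b e) with (a b c) or (a b d) has square 1; this
    carries over to the images, so that [third_common_arc] applies to them. *)
Lemma automorphism_arc phi (a b c d a' b' : X) (gc gd : G) :
  automorphism phi -> uniq [:: a; b; c; d] -> a' != b' ->
  val gc = cyc a b c -> val gd = cyc a b d ->
  val (phi gc) a' = b' -> val (phi gd) a' = b' ->
  forall e g, e != a -> e != b -> val g = cyc a b e -> val (phi g) a' = b'.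
Proof.
move=> phi_aut abcd a'b' gcE gdE tc td e g ea eb gE.
have [F phiF] := automorphism_morphism phi_aut.
have [-> //|ce] := eqVneq g gc; have [-> //|de] := eqVneq g gd.
have [abc [abd cd]] : uniq [:: a; b; c] /\ uniq [:: a; b; d] /\ c != d.
  move: abcd; rewrite !uniq3 /= !inE !negb_or.
  by move=> /and4P[/and3P[-> -> ->] /andP[-> ->]]; rewrite /= => ->.
have image_square h x : e != x -> uniq [:: a; b; x] -> val h = cyc a b x ->
    (val (phi h) * val (phi g)) ^+ 2 = 1.
  move=> ex abx hE; rewrite phiF -!valM -gmulfM -!gmulfXn.
  have -> : (h * g) ^+ 2 = 1; last by rewrite !gmulf1.
  apply: val_inj; rewrite gmulfXn val1 gmulfM /= hE gE cyc_arc_square //.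
  by rewrite (rcons_uniq [:: a; b; x]) abx !inE !negb_or ea eb ex.
have image3 h x : uniq [:: a; b; x] -> val h = cyc a b x ->
    three_cycle (val (phi h)).
  move=> abx hE; apply: automorphism_three_cycle => //.
  by rewrite hE; apply: three_cycle_cyc.
have [ca' cb' tcE] := three_cycle_arc (image3 gc c abc gcE) a'b' tc.
have [da' db' tdE] := three_cycle_arc (image3 gd d abd gdE) a'b' td.
have abe : uniq [:: a; b; e].
  by move: abc; rewrite !uniq3 ![_ == e]eq_sym ea eb => /and3P[->].
have ec : e != c by apply: contra ce => /eqP ec; apply/eqP/val_inj; rewrite gE ec.
have ed : e != d by apply: contra de => /eqP ed; apply/eqP/val_inj; rewrite gE ed.
apply: (third_common_arc X_inf (c := val (phi gc) b') (d := val (phi gd) b')).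
- rewrite (rcons_uniq [:: a'; b'; _]) uniq3 a'b' !inE !negb_or da' db'.
  rewrite ![_ == val (phi gc) _]eq_sym ca' cb' /= !andbT.
  apply: contra cd => /eqP cd'; have : gc = gd.
    apply: val_inj; have [[psi phiK _] _] := phi_aut.
    rewrite -[gc]phiK -[gd]phiK; congr (val (psi _)).
    by apply: val_inj; rewrite tcE tdE cd'.
  by move/(congr1 (fun g : G => val g b)); rewrite gcE gdE !cyc2 => ->.
- exact: image3 abe gE.
- by rewrite -tcE; apply: (image_square gc c).
- by rewrite -tdE; apply: (image_square gd d).
Qed.

(** The map r is built from the arc a -> b common to the images of the 3-cycles
    (a0 b0 e).  It is onto because the inverse automorphism maps 3-cycles with arc
    a -> b to 3-cycles with arc a0 -> b0. *)
Lemma automorphism_conj phi : automorphism phi ->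
  exists r : Sym X, forall g : G, val (phi g) = val g ^ r.
Proof.
move=> phi_aut; have [F phiF] := automorphism_morphism phi_aut.
have [[psi phiK psiK] _] := phi_aut.
have psi_aut := automorphism_inv phi_aut phiK psiK.
have [h h_inj _] := numbering [::] X_inf (isT : uniq ([::] : seq X)) (erefl 0).
pose a0 := h 0; pose b0 := h 1%N; pose c0 := h 2; pose d0 := h 3.
have abcd0 : uniq [:: a0; b0; c0; d0].
  by rewrite -[X in uniq X]/(map h [:: 0; 1%N; 2; 3]) (map_inj_uniq h_inj).
have uniq_arc (a b e : X) : a != b -> e != a -> e != b -> uniq [:: a; b; e].
  by move=> ab ea eb; rewrite uniq3 ab ![_ == e]eq_sym ea eb.
have ab0 : a0 != b0 by rewrite (inj_eq h_inj).
pose tau (a b e : X) : G := insubd 1 (cyc a b e).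
have tauE (a b e : X) : a != b -> e != a -> e != b -> val (tau a b e) = cyc a b e.
  move=> ab ea eb; rewrite insubdK //; apply: FAlt_G; apply: cyc_FAlt.
  exact: uniq_arc.
have tau3 f (a b e : X) : automorphism f -> a != b -> e != a -> e != b ->
    three_cycle (val (f (tau a b e))).
  move=> f_aut ab ea eb; apply: automorphism_three_cycle => //.
  by rewrite tauE //; apply: three_cycle_cyc; apply: uniq_arc.
have [ca cb da db] : [/\ c0 != a0, c0 != b0, d0 != a0 & d0 != b0].
  by rewrite !(inj_eq h_inj).
(* The images of (a0 b0 c0) and (a0 b0 d0) are not inverse to each other, so they
   have a common arc a -> b. *)
have [a [b [ab tc td]]] : exists a b, [/\ a != b, val (phi (tau a0 b0 c0)) a = b
    & val (phi (tau a0 b0 d0)) a = b].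
  have [//|||inv|[p tp tdp]] := @common_arc _ X_inf
      (val (phi (tau a0 b0 c0))) (val (phi (tau a0 b0 d0))).
  - exact: tau3.
  - exact: tau3.
  - rewrite phiF -!valM -gmulfM -!gmulfXn.
    have -> : (tau a0 b0 c0 * tau a0 b0 d0) ^+ 2 = 1; last by rewrite !gmulf1.
    by apply: val_inj; rewrite gmulfXn gmulfM /= !tauE // val1 cyc_arc_square.
  - have : tau a0 b0 d0 = (tau a0 b0 c0)^-1.
      rewrite -[LHS]phiK -[RHS]phiK; congr psi; apply: val_inj; rewrite inv.
      by rewrite phiF !gmulfV.
    move=> {}inv; have : cyc a0 b0 d0 = (cyc a0 b0 c0)^-1.
      by rewrite -!tauE // inv gmulfV.
    move/(congr1 (fun s : Sym X => cyc a0 b0 c0 (s b0))); rewrite symKV cyc2.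
    rewrite cyc_out ?inE ?(inj_eq h_inj) // => /h_inj.
    by [].
  - by exists p, (val (phi (tau a0 b0 c0)) p); split=> //; rewrite eq_sym; apply/eqP.
have arc e : e != a0 -> e != b0 -> val (phi (tau a0 b0 e)) a = b.
  move=> ea eb; apply: (automorphism_arc phi_aut abcd0 ab _ _ tc td ea eb).
  - exact: tauE.
  - exact: tauE.
  - exact: tauE.
pose r0 e := val (phi (tau a0 b0 e)) b.
have r0P e : e != a0 -> e != b0 ->
    [/\ r0 e != a, r0 e != b & val (phi (tau a0 b0 e)) = cyc a b (r0 e)].
  by move=> ea eb; apply: three_cycle_arc (arc e ea eb) => //; apply: tau3.
have r0_inj e f : e != a0 -> e != b0 -> f != a0 -> f != b0 -> r0 e = r0 f -> e = f.
  move=> ea eb fa fb ef; have [_ _ eE] := r0P e ea eb; have [_ _ fE] := r0P f fa fb.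
  have : tau a0 b0 e = tau a0 b0 f.
    by rewrite -[LHS]phiK -[RHS]phiK; congr psi; apply: val_inj; rewrite eE fE ef.
  by move/(congr1 (fun g : G => val g b0)); rewrite !tauE // !cyc2.
have arc_inv y : y != a -> y != b -> val (psi (tau a b y)) a0 = b0.
  move=> ya yb; have [ca' cb' cE] := r0P c0 ca cb; have [da' db' dE] := r0P d0 da db.
  have abcd : uniq [:: a; b; r0 c0; r0 d0].
    rewrite (rcons_uniq [:: a; b; _]) uniq_arc // !inE !negb_or da' db' /= !andbT.
    apply/eqP => /r0_inj dc; have := dc da db ca cb.
    by apply/eqP; rewrite (inj_eq h_inj).
  apply: (automorphism_arc psi_aut abcd ab0 cE dE _ _ ya yb); last exact: tauE.
  - by rewrite phiK tauE // cyc1 // eq_sym.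
  - by rewrite phiK tauE // cyc1 // eq_sym.
have r0_surj y : y != a -> y != b -> exists e, [/\ e != a0, e != b0 & r0 e = y].
  move=> ya yb.
  have psi3 := tau3 psi a b y psi_aut ab ya yb.
  have [ea eb vE] := three_cycle_arc psi3 ab0 (arc_inv y ya yb).
  exists (val (psi (tau a b y)) b0); split=> //.
  have psiE : psi (tau a b y) = tau a0 b0 (val (psi (tau a b y)) b0).
    by apply: val_inj; rewrite [RHS]tauE.
  by rewrite /r0 -psiE psiK tauE // cyc2.
pose r x := if x == a0 then a else if x == b0 then b else r0 x.
have r_inj : injective r.
  move=> x y; rewrite /r.
  have [->|xa] := eqVneq x a0; have [->|ya] := eqVneq y a0 => //.
  - have [_ e|yb e] := eqVneq y b0; first by rewrite e eqxx in ab.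
    by have [+ _ _] := r0P y ya yb; rewrite -e eqxx.
  - have [_ e|xb e] := eqVneq x b0; first by rewrite e eqxx in ab.
    by have [+ _ _] := r0P x xa xb; rewrite e eqxx.
  - have [->|xb] := eqVneq x b0; have [->|yb] := eqVneq y b0 => //.
    + by move=> e; have [_ + _] := r0P y ya yb; rewrite -e eqxx.
    + by move=> e; have [_ + _] := r0P x xa xb; rewrite e eqxx.
    + exact: r0_inj.
have /choice[r' rr'] : forall y, exists x, r x = y.
  move=> y; have [->|ya] := eqVneq y a; first by exists a0; rewrite /r eqxx.
  have [->|yb] := eqVneq y b; first by exists b0; rewrite /r eqxx eq_sym (negPf ab0).
  have [e [ea eb <-]] := r0_surj y ya yb.
  by exists e; rewrite /r (negPf ea) (negPf eb).
have r'r : cancel r r' by move=> x; apply: r_inj; rewrite rr'.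
pose rho := MkSym r'r rr'.
have rho_gen : forall t, three_cycle t ->
    exists2 g : G, val g = t & val (phi g) = t ^ rho.
  apply: (three_cycles_generate X_inf ab0).
  - move=> _ _ [g <- gE] [k <- kE]; exists (g * k); first by rewrite gmulfM.
    by rewrite conjMg -gE -kE phiF !gmulfM.
  - move=> _ [g <- gE]; exists g^-1; first by rewrite gmulfV.
    by rewrite conjVg -gE phiF !gmulfV.
  - move=> e ea eb; exists (tau a0 b0 e); first exact: tauE.
    have [_ _ ->] := r0P e ea eb.
    by rewrite cycJ /= /r eqxx eq_sym (negPf ab0) eqxx (negPf ea) (negPf eb).
exists rho => g; rewrite conjgE.
suff -> : val g * rho = rho * val (phi g) by rewrite mulKg.
(* For a 3-cycle u, the conjugate u ^ val g is again a 3-cycle, and phi is already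
   known to be conjugation by rho on both of them. *)
apply: (conj_three_cycles_inj X_inf) => u u3; rewrite !conjgM.
have [k kE <-] := rho_gen _ (three_cycleJ (val g) u3).
have [l lE <-] := rho_gen _ u3.
have -> : k = l ^ g by apply: val_inj; rewrite kE -lE gmulfJ.
by rewrite phiF !gmulfJ.
Qed.

End Automorphisms.

(** * Fixed points in a coset of the alternating group *)

Section FixedPoints.
Variable X : choiceType.

(** Since s fixes x^-1 q as soon as t fixes q, the hypothesis allows to iterate:
    s fixes x^-k p for all k > 0, in particular for k the order of x. *)
Lemma fixed_points_conj_torsion (s t x : Sym X) n : x ^+ n.+1 = 1 -> s ^ x = t ->
  (forall p, s p = p -> t p = p) -> forall p, t p = p -> s p = p.
Proof.
move=> xn stx st p tp.
have back q : t q = q -> s (x^-1 q) = x^-1 q.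
  by rewrite -stx conjgE !symM => e; apply: (@sym_inj _ x); rewrite e symKV.
have /(_ n) : forall k, s ((x^-1 ^+ k.+1) p) = (x^-1 ^+ k.+1) p.
  elim=> [|k IHk]; first by rewrite expg1; apply: back.
  by rewrite expgSr symM; apply/back/st.
by rewrite expVgn xn invg1.
Qed.

(** Multiplying s by (s p, p, c) fixes p, and keeps the fixed points of s when all
    three points of the cycle are moved by s. *)
Lemma more_fixed_points (s : Sym X) : infinite_set [set p | s p <> p] ->
  exists a, [/\ FAlt X a, infinite_set [set p | (s * a) p <> p],
    forall p, s p = p -> (s * a) p = p & exists2 p, (s * a) p = p & s p <> p].
Proof.
move=> s_inf; have [p sp _] := fresh_point [::] s_inf.
have [c sc] := fresh_point [:: p; s p] s_inf; rewrite !inE negb_or => /andP[cp csp].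
have puc : uniq [:: s p; p; c].
  by rewrite uniq3 ![_ == c]eq_sym csp cp !andbT; apply/eqP.
exists (cyc (s p) p c); split.
- exact: cyc_FAlt.
- have := infinite_setD s_inf (finite_seq [:: p; s^-1 p; s^-1 c]).
  apply: sub_infinite_set => x [sx /negP]; rewrite -(mem_map (@sym_inj _ s)).
  rewrite -[map _ _]/[:: s p; s (s^-1 p); s (s^-1 c)] !symKV => xs.
  by rewrite /mkset symM cyc_out.
- move=> x sx; rewrite symM sx cyc_out // !inE !negb_or; apply/and3P; split.
  + by apply/eqP => e; apply: sp; apply: (@sym_inj _ s); rewrite -e sx.
  + by apply/eqP => e; apply: sp; rewrite -e.
  + by apply/eqP => e; apply: sc; rewrite -e.
- exists p => //; rewrite symM cyc1 //; last by rewrite eq_sym.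
  by rewrite eq_sym; apply/eqP.
Qed.

(** Multiplying s by a 3-cycle on three of its fixed points moves these three and
    keeps all other fixed points. *)
Lemma fewer_fixed_points (s : Sym X) : infinite_set [set p | s p = p] ->
  exists a, [/\ FAlt X a, infinite_set [set p | (s * a) p = p],
    forall p, (s * a) p = p -> s p = p & exists2 p, s p = p & (s * a) p <> p].
Proof.
move=> s_inf; have [p sp _] := fresh_point [::] s_inf.
have [q sq qp] := fresh_point [:: p] s_inf.
have [c sc] := fresh_point [:: p; q] s_inf; rewrite !inE negb_or => /andP[cp cq].
move: qp; rewrite inE => qp.
have pqc : uniq [:: p; q; c] by rewrite uniq3 ![_ == c]eq_sym eq_sym qp cp cq.
exists (cyc p q c); split.
- exact: cyc_FAlt.
- have := infinite_setD s_inf (finite_seq [:: p; q; c]).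
  by apply: sub_infinite_set => x [sx /negP xs]; rewrite /mkset symM sx cyc_out.
- move=> x; have [|xs] := boolP (x \in [:: p; q; c]).
    by rewrite !inE => /or3P[] /eqP->.
  rewrite symM cyc_out //; move: xs; rewrite !inE -{2}sp -{2}sq -{2}sc.
  by rewrite !(inj_eq (@sym_inj _ s)).
- exists p => //; rewrite symM sp cyc1 // 1?eq_sym //.
  by move/eqP; rewrite (negPf qp).
Qed.

Definition fixes_more (s t : Sym X) :=
  (forall p, s p = p -> t p = p) /\ exists2 p, t p = p & s p <> p.

Lemma fixes_more_trans (s t u : Sym X) :
  fixes_more s t -> fixes_more t u -> fixes_more s u.
Proof.
move=> [st [p tp sp]] [tu _]; split; first by move=> q /st/tu.
by exists p => //; apply: tu.
Qed.

Lemma conj_torsion_fixes_more (s t x : Sym X) n : (0 < n)%N -> x ^+ n = 1 ->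
  s ^ x = t -> ~ fixes_more s t /\ ~ fixes_more t s.
Proof.
case: n => // n _ xn stx; split=> -[le [p + np]].
  by move/(fixed_points_conj_torsion xn stx le).
have txs : t ^ x^-1 = s by rewrite -stx conjgK.
have xVn : x^-1 ^+ n.+1 = 1 by rewrite expVgn xn invg1.
by move/(fixed_points_conj_torsion xVn txs le).
Qed.

Lemma FAlt_chain (Q : Sym X -> Prop) (R : Sym X -> Sym X -> Prop) r :
  (forall s t u, R s t -> R t u -> R s u) ->
  (forall s, Q s -> exists a, [/\ FAlt X a, Q (s * a) & R s (s * a)]) -> Q r ->
  exists a : nat -> Sym X, (forall k, FAlt X (a k)) /\
    forall i j, (i < j)%N -> R (r * a i) (r * a j).
Proof.
move=> Rtrans step Qr.
have /choice[next nextP] : forall s, exists a,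
    Q s -> [/\ FAlt X a, Q (s * a) & R s (s * a)].
  move=> s; have [/step[a]|] := EM (Q s); first by exists a.
  by exists 1.
pose a := fix a k := if k is k'.+1 then a k' * next (r * a k') else 1.
have aP k : FAlt X (a k) /\ Q (r * a k).
  elim: k => [|k [Fk Qk]] /=; first by rewrite mulg1; split=> //; exact: FAlt1.
  have [Fn Qn _] := nextP _ Qk; rewrite mulgA; split=> //; exact: FAltM.
have aR k : R (r * a k) (r * a k.+1).
  by have [_ Qk] := aP k; have [_ _] := nextP _ Qk; rewrite /= mulgA.
exists a; split=> [k|i]; first by have [] := aP k.
elim=> // j IHj; rewrite ltnS leq_eqVlt => /predU1P[-> //|/IHj ij].
exact: Rtrans ij (aR j).
Qed.

Lemma FAlt_coset_chain (r : Sym X) : infinite_set [set: X] ->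
  exists a : nat -> Sym X, (forall k, FAlt X (a k)) /\ forall i j, i <> j ->
    fixes_more (r * a i) (r * a j) \/ fixes_more (r * a j) (r * a i).
Proof.
move=> X_inf.
have [moved_fin|moved_inf] := EM (finite_set [set p | r p <> p]); last first.
  have step (s : Sym X) : infinite_set [set p | s p <> p] -> exists a, [/\ FAlt X a,
      infinite_set [set p | (s * a) p <> p] & fixes_more s (s * a)].
    by move=> /more_fixed_points[a [Fa inf_a le lt]]; exists a; split.
  have [a [FA aR]] := FAlt_chain fixes_more_trans step moved_inf.
  by exists a; split=> // i j ij; case: (ltngtP i j) => [/aR|/aR|//]; [left|right].
have fixed_inf : infinite_set [set p | r p = p].
  have := infinite_setD X_inf moved_fin; apply: sub_infinite_set => p [_ /=].
  exact: contrapT.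
have step (s : Sym X) : infinite_set [set p | s p = p] -> exists a, [/\ FAlt X a,
    infinite_set [set p | (s * a) p = p] & fixes_more (s * a) s].
  by move=> /fewer_fixed_points[a [Fa inf_a le lt]]; exists a; split.
have trans (s t u : Sym X) : fixes_more t s -> fixes_more u t -> fixes_more u s.
  by move=> ts ut; apply: fixes_more_trans ut ts.
have [a [FA aR]] := FAlt_chain trans step fixed_inf.
by exists a; split=> // i j ij; case: (ltngtP i j) => [/aR|/aR|//]; [right|left].
Qed.

End FixedPoints.

(** * Twisted classes *)

(** Points are compared by boolean equality throughout, hence the choiceType;
    the carrier [{classic X}] extends the result to an arbitrary type X. *)
Theorem R_infty_of_torsion
    (X : choiceType) (P : pred (Sym X)) (G : subGroupType P) :
  infinite_set [set: X] -> torsion G -> FAlt X `<=` [set` P] -> R_infty G.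
Proof.
move=> X_inf G_torsion FAlt_G phi phi_aut.
have [r rE] := automorphism_conj X_inf FAlt_G phi_aut.
have [a [Fa aR]] := FAlt_coset_chain r X_inf.
have /choice[g gE] : forall k, exists g : G, val g = a k.
  by move=> k; have [g gE] := FAlt_lift G FAlt_G (Fa k); exists g.
have class_inj : injective (fun k => twisted_class phi (g k)).
  move=> i j /seteqP[_ /(_ (g j))]; rewrite /twisted_class /=.
  case=> [|x xE].
    have [F ->] := automorphism_morphism phi_aut.
    by exists 1; rewrite invg1 gmulf1 mul1g mulg1.
  apply: contrapT => /aR.
  have [n n_gt0 xn] := G_torsion x.
  have valxn : val x ^+ n = 1 by rewrite -gmulfXn xn gmulf1.
  (* Multiply phi x^-1 * g i * x = g j by r on the left. *)
  have conj_x : (r * a i) ^ val x = r * a j.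
    by rewrite -!gE -xE !gmulfM /= rE gmulfV /= !conjgE !mulgA mulgV mul1g.
  by have [? ?] := conj_torsion_fixes_more n_gt0 valxn conj_x; case.
apply: (@sub_infinite_set _ (range (fun k => twisted_class phi (g k)))).
  by move=> _ [k _ <-]; exists (g k).
have gi := @inj_card_eq _ _ [set: nat] _ (in2W class_inj).
by rewrite (eq_finite_set gi); apply: infinite_nat.
Qed.

Theorem corollary3p7 (X : Type) (P : pred (Sym X)) (G : subGroupType P)
    (X_infinite : infinite_set [set: X])
    (G_infinite : infinite_set [set: G])
    (G_torsion : torsion G)
    (FAlt_sub_G : FAlt X `<=` [set` P]) :
  R_infty G.
Proof. exact: (@R_infty_of_torsion {classic X} P G). Qed.
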